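(* Let $R_n(x)=Q_n(x)+\overline{Q}_n(x)$ be a polynomial of order $n$ with real coefficients and which has as roots the $n$ solutions $\lambda_1,\ldots,\lambda_n$ of the equations $$\arctan\left(\frac{1}{\sqrt{4\lambda_k-1}}\right)+2\sum_{i=1}^{n}\arctan\left(\frac{\alpha_i}{\sqrt{4\lambda_k-1}}\right)=(2k-1)\frac{\pi}{2},\qquad k=1,\ldots,n,$$ when $\alpha_i\ge 0$ for all $i$. Then the real part of the complex polynomial $Q_n(x)$ satisfies the recurrence equation $$\Re\{Q_n(x)\}=\left(\frac{(4x-1)-\alpha_n\alpha_{n-1}}{\alpha_{n-1}}\right)\left(\frac{\alpha_n+\alpha_{n-1}}{4}\right)\Re\{Q_{n-1}(x)\}-\frac{\alpha_n}{\alpha_{n-1}}\left(x+\frac{\alpha_{n-1}^2-1}{4}\right)^2\Re\{Q_{n-2}(x)\},$$ with initial conditions $\Re\{Q_0(x)\}=1$ and $\Re\{Q_1(x)\}=x-\frac{(\alpha_1+1)^2}{4}$.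
   Context: Here $\alpha_1,\ldots,\alpha_n$ are real parameters, $Q_n(x)$ is a polynomial with complex coefficients, $\overline{Q}_n(x)$ is its complex conjugate, and $\Re\{\cdot\}$ denotes the real part.
   Formalization: R_n is normalized to have leading coefficient 2 (its roots fix it only up to a scalar, and the initial conditions fail for other scalings); the recurrence is stated for α_{n-1} ≠ 0; at 4λ_k = 1 the arctangents are read as limits. *)

(* Defs.v *)
From HB Require Import structures.
From mathcomp Require Import all_boot all_order all_algebra.
From mathcomp Require Import all_classical all_reals all_analysis.
From mathcomp Require Import complex.

Set Implicit Arguments.
Unset Strict Implicit.
Unset Printing Implicit Defensive.

Import Order.TTheory GRing.Theory Num.Theory.
Local Open Scope ring_scope.
Local Open Scope complex_scope.

(* arctan (a / s) for a, s >= 0.  At s = 0, where a / s is undefined, this is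
   the limit for s -> 0+: pi / 2 if a > 0, and 0 if a = 0. *)
Definition arctan_div (R : realType) (a s : R) : R :=
  if s == 0 then (if a == 0 then 0 else pi / 2) else atan (a / s).

(* The parameters are alpha 1, ..., alpha n; alpha 0 is not used. *)
Definition arctan_sum (R : realType) (alpha : nat -> R) (n : nat) (x : R) : R :=
  arctan_div 1 (Num.sqrt (4 * x - 1))
  + 2 * \sum_(1 <= i < n.+1) arctan_div (alpha i) (Num.sqrt (4 * x - 1)).

(* The bound keeps 4 x - 1 in the domain of the real square root, as Num.sqrt
   is 0 on negative numbers. *)
Definition solves_arctan_eq (R : realType) (alpha : nat -> R) (n k : nat)
    (x : R) : Prop :=
  1 / 4 <= x /\ arctan_sum alpha n x = (2 * k%:R - 1) * (pi / 2).

Definition conj_poly (R : realType) (q : {poly R[i]}) : {poly R[i]} :=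
  map_poly (@conjc R) q.

Definition Re_at (R : realType) (q : {poly R[i]}) (x : R) : R :=
  complex.Re q.[x%:C].

(* r = q + conj q is a real polynomial of degree n whose roots are the
   solutions lambda 1, ..., lambda n.  The roots determine r only up to a
   scalar, and the recurrence is not invariant under rescaling its members
   separately; the normalization lead_coef r = 2 says that the real part
   r / 2 of q is monic, as it is in the initial conditions. *)
Definition arctan_poly (R : realType) (alpha : nat -> R) (n : nat)
    (lambda : nat -> R) (r : {poly R}) (q : {poly R[i]}) : Prop :=
  [/\ map_poly (real_complex R) r = q + conj_poly q,
      size r = n.+1,
      lead_coef r = 2 &
      forall k : nat, (1 <= k <= n)%N ->
        solves_arctan_eq alpha n k (lambda k) /\ root r (lambda k)].

(* Main.v *)
Require Import Defs.
From HB Require Import structures.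
From mathcomp Require Import all_boot all_order all_algebra.
From mathcomp Require Import all_classical all_reals all_analysis.
From mathcomp Require Import complex.
From mathcomp Require Import ring lra.

(** Put s = sqrt (4 x - 1).  The left-hand side of the arctangent equation is
    the argument of the complex number
      z_n = (s + i) (s + i alpha_1)^2 ... (s + i alpha_n)^2,
    so the equation puts z_n on the imaginary axis.  In the
    expansion of z_n, a term with j factors i has degree 2 n + 1 - j in s, so
    the real part is odd in s and the imaginary part is even.  Hence
    Re z_n = s * 4 ^ n * A_n (x) and Im z_n = 4 ^ n * B_n (x) for polynomials
    A_n and B_n in x, with A_n monic of degree n: these are the two components
    of [tangent_pair].

    A solution lambda_k > 1 / 4 is therefore a root of A_n
    ([root_of_solution]).  A solution at 1 / 4, where the factor s vanishes, is
    a root too: there every nonzero alpha_i adds pi to the argument, so an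
    index k <= n is reached only if some alpha_i is 0; then s ^ 2 divides
    z_n, and A_n (1 / 4) = 0.  The n values lambda_k are distinct because the
    right-hand sides are, so r and 2 A_n, of degree n with the same leading
    coefficient, have n common roots and are equal ([arctan_poly_unique]):
    the real part of Q_n is A_n.

    The recurrence is the elimination of B_(n-1) between the real part of
    z_n = z_(n-1) (s + i alpha_n)^2 and that of
    z_(n-2) (s^2 + alpha_(n-1)^2)^2 = z_(n-1) (s - i alpha_(n-1))^2. *)

Import Order.TTheory GRing.Theory Num.Theory.
Local Open Scope ring_scope.

(** Multiplying s A + i B by (s + i a)^2 / 4, where s^2 = 4 x - 1, gives the
    two components of the recursive case; the factor 1 / 4 keeps the first one
    monic. *)
Fixpoint tangent_pair (R : realType) (alpha : nat -> R) (n : nat) :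
    {poly R} * {poly R} :=
  if n is m.+1 then
    let: (A, B) := tangent_pair R alpha m in
    let a := alpha m.+1 in
    (('X - ((1 + a ^+ 2) / 4)%:P) * A - (a / 2) *: B,
     ('X - ((1 + a ^+ 2) / 4)%:P) * B + (a / 2) *: ((4 *: 'X - 1) * A))
  else (1, 1).

Definition tangent_re (R : realType) (alpha : nat -> R) (n : nat) : {poly R} :=
  (tangent_pair R alpha n).1.

Definition tangent_im (R : realType) (alpha : nat -> R) (n : nat) : {poly R} :=
  (tangent_pair R alpha n).2.

Lemma tangent_reS (R : realType) (alpha : nat -> R) (n : nat) :
  tangent_re R alpha n.+1 =
    ('X - ((1 + alpha n.+1 ^+ 2) / 4)%:P) * tangent_re R alpha n
    - (alpha n.+1 / 2) *: tangent_im R alpha n.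
Proof. by rewrite /tangent_re /tangent_im /=; case: tangent_pair. Qed.

Lemma tangent_imS (R : realType) (alpha : nat -> R) (n : nat) :
  tangent_im R alpha n.+1 =
    ('X - ((1 + alpha n.+1 ^+ 2) / 4)%:P) * tangent_im R alpha n
    + (alpha n.+1 / 2) *: ((4 *: 'X - 1) * tangent_re R alpha n).
Proof. by rewrite /tangent_re /tangent_im /=; case: tangent_pair. Qed.

Lemma horner_tangent_reS (R : realType) (alpha : nat -> R) (n : nat) (x : R) :
  (tangent_re R alpha n.+1).[x] =
    (x - (1 + alpha n.+1 ^+ 2) / 4) * (tangent_re R alpha n).[x]
    - alpha n.+1 / 2 * (tangent_im R alpha n).[x].
Proof. by rewrite tangent_reS !hornerE. Qed.

Lemma horner_tangent_imS (R : realType) (alpha : nat -> R) (n : nat) (x : R) :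
  (tangent_im R alpha n.+1).[x] =
    (x - (1 + alpha n.+1 ^+ 2) / 4) * (tangent_im R alpha n).[x]
    + alpha n.+1 / 2 * ((4 * x - 1) * (tangent_re R alpha n).[x]).
Proof. by rewrite tangent_imS !hornerE. Qed.

Lemma size_tangent (R : realType) (alpha : nat -> R) (n : nat) :
  [/\ tangent_re R alpha n \is monic, size (tangent_re R alpha n) = n.+1
    & (size (tangent_im R alpha n) <= n.+1)%N].
Proof.
elim: n => [|n [mA sA sB]].
  by rewrite /tangent_re /tangent_im /= monic1 size_poly1.
have sXA : size (('X - ((1 + alpha n.+1 ^+ 2) / 4)%:P) * tangent_re R alpha n)
    = n.+2.
  rewrite size_monicM ?monicXsubC ?monic_neq0 // size_XsubC sA //.
have sB' : (size (- (alpha n.+1 / 2 *: tangent_im R alpha n)) < n.+2)%N.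
  by rewrite size_polyN ltnS (leq_trans (size_scale_leq _ _)).
split.
- rewrite tangent_reS monicE lead_coefDl ?sXA //.
  by rewrite -monicE monicMr ?monicXsubC.
- by rewrite tangent_reS size_polyDl sXA.
rewrite tangent_imS (leq_trans (size_polyD _ _)) // geq_max; apply/andP; split.
  rewrite (leq_trans (size_polyMleq _ _)) // size_XsubC /=.
  exact: leq_trans sB _.
rewrite (leq_trans (size_scale_leq _ _)) // (leq_trans (size_polyMleq _ _)) //.
rewrite sA addnS /=.
have : (size (4 *: 'X - 1 : {poly R})%R <= 2)%N.
  rewrite (leq_trans (size_polyD _ _)) // size_polyN size_poly1 geq_max.
  by rewrite (leq_trans (size_scale_leq _ _)) ?size_polyX.
by move=> h; rewrite -[n.+2]/(2 + n)%N leq_add2r.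
Qed.

(** The point (s, a) has polar angle [arctan_div a s].  Allowing the radius
    c to be 0 or negative makes this hold also for s = 0 and for a = s = 0, so
    that products of such points can be handled without case distinctions. *)
Lemma arctan_div_polar (R : realType) (a s : R) :
  exists c : R, s = c * cos (arctan_div a s) /\ a = c * sin (arctan_div a s).
Proof.
rewrite /arctan_div; case: eqP => [->|/eqP s0].
  case: eqP => [->|_]; first by exists 0; rewrite !mul0r.
  by exists a; rewrite cos_pihalf sin_pihalf mulr0 mulr1.
have c0 : cos (atan (a / s)) != 0.
  by rewrite gt_eqF // cos_gt0_pihalf // atan_gtNpi2 atan_ltpi2.
exists (s / cos (atan (a / s))); split; first by rewrite divfK.
have := atanK (a / s); rewrite /tan => e.
by rewrite mulrAC -mulrA e mulrC divfK.
Qed.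

Lemma arctan_sumS (R : realType) (alpha : nat -> R) (n : nat) (x : R) :
  arctan_sum alpha n.+1 x =
    arctan_sum alpha n x + 2 * arctan_div (alpha n.+1) (Num.sqrt (4 * x - 1)).
Proof. by rewrite /arctan_sum big_nat_recr //= mulrDr addrA. Qed.

(** The modulus [rho] is left unspecified: only the direction of s A + i B
    matters for deciding when it lies on the imaginary axis. *)
Lemma tangent_polar (R : realType) (alpha : nat -> R) (n : nat) (x : R) :
  1 / 4 <= x ->
  exists rho : R,
    Num.sqrt (4 * x - 1) * (tangent_re R alpha n).[x]
      = rho * cos (arctan_sum alpha n x) /\
    (tangent_im R alpha n).[x] = rho * sin (arctan_sum alpha n x).
Proof.
move=> x4; have s2 : Num.sqrt (4 * x - 1) ^+ 2 = 4 * x - 1.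
  by rewrite sqr_sqrtr //; lra.
elim: n => [|n [rho [hA hB]]].
  have [c [hs h1]] := arctan_div_polar R 1 (Num.sqrt (4 * x - 1)).
  exists c; rewrite /arctan_sum big_geq // mulr0 addr0.
  by rewrite /tangent_re /tangent_im /= !hornerE -h1.
have [c [hs ha]] := arctan_div_polar R (alpha n.+1) (Num.sqrt (4 * x - 1)).
(* Multiplication by (s + i a)^2 = c^2 e^(2 i u) scales the modulus by c^2;
   the division by 4 is the normalization of [tangent_pair]. *)
exists (rho * c ^+ 2 / 4).
rewrite arctan_sumS horner_tangent_reS horner_tangent_imS.
move: hA hB hs ha s2; set s := Num.sqrt _; set A := _.[x]; set B := _.[x].
set t := arctan_sum _ _ _; set u := arctan_div _ _; set a := alpha _.
move=> hA hB hs ha s2.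
clearbody A B t u a s; rewrite mulr_natl mulr2n !(cosD, sinD).
have -> : x = (s ^+ 2 + 1) / 4 by rewrite s2; field.
split.
  transitivity ((((s ^+ 2 - a ^+ 2) * (s * A)) - 2 * s * a * B) / 4).
    by field.
  by rewrite hA hB hs ha; field.
transitivity ((((s ^+ 2 - a ^+ 2) * B) + 2 * s * a * (s * A)) / 4).
  by field.
by rewrite hA hB hs ha; field.
Qed.

Lemma cos_odd_pihalf (R : realType) (k : nat) :
  cos ((2 * k%:R - 1) * (pi / 2)) = 0 :> R.
Proof.
have -> : (2 * k%:R - 1) * (pi / 2) = - (pi / 2) + k%:R * pi :> R by field.
elim: k => [|k IH]; first by rewrite mul0r addr0 cosN cos_pihalf.
by rewrite -(natr1 k) (mulrDl k%:R) mul1r addrA cosDpi IH oppr0.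
Qed.

Lemma arctan_sum_quarter (R : realType) (alpha : nat -> R) (n : nat) :
  (forall i : nat, (1 <= i <= n)%N -> alpha i != 0) ->
  arctan_sum alpha n (1 / 4) = (2 * n%:R + 1) * (pi / 2).
Proof.
move=> a0; have s0 : Num.sqrt (4 * (1 / 4) - 1) = 0 :> R.
  by rewrite [X in Num.sqrt X](_ : _ = 0) ?sqrtr0 //; field.
rewrite /arctan_sum s0 /arctan_div eqxx oner_eq0.
rewrite (eq_big_nat _ _ (F2 := fun=> pi / 2)) => [|i hi].
  by rewrite sumr_const_nat subn1 /= -mulr_natl; field.
by rewrite (negbTE (a0 _ _)).
Qed.

(** A zero parameter contributes the factor s^2 to z_n, which then vanishes at
    s = 0 even after division by s. *)
Lemma tangent_quarter_eq0 (R : realType) (alpha : nat -> R) (n j : nat) :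
  (1 <= j <= n)%N -> alpha j = 0 ->
  (tangent_re R alpha n).[1 / 4] = 0 /\ (tangent_im R alpha n).[1 / 4] = 0.
Proof.
elim: n => [|n IH]; first by case: j.
move=> /andP[j1]; rewrite leq_eqVlt => /orP[/eqP ej|jn] aj;
  rewrite horner_tangent_reS horner_tangent_imS.
  by rewrite -ej aj; split; field.
have [|-> ->] := IH _ aj; first by rewrite j1.
by split; field.
Qed.

Lemma root_of_solution (R : realType) (alpha : nat -> R) (n k : nat) (x : R) :
  (1 <= k <= n)%N -> solves_arctan_eq alpha n k x ->
  root (tangent_re R alpha n) x.
Proof.
move=> /andP[k1 kn] [x4 e]; apply/rootP.
have [rho [hA _]] := tangent_polar R alpha n x x4.
move: hA; rewrite e cos_odd_pihalf mulr0 => /eqP.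
rewrite mulf_eq0 sqrtr_eq0 => /orP[xle|/eqP//].
have x14 : x = 1 / 4 by apply/le_anti; rewrite x4 andbT; lra.
move: e; rewrite x14 => {x x4 xle x14} e.
case: (pselect (exists2 j : nat, (1 <= j <= n)%N & alpha j = 0)).
  by case=> j jn aj; case: (tangent_quarter_eq0 R alpha n j jn aj).
move=> noz; exfalso.
(* The argument at 1 / 4 is then (2 n + 1) pi / 2, which exceeds the
   right-hand sides for all k <= n. *)
have := arctan_sum_quarter R alpha n; rewrite e => /(_ _)/wrap[].
  by move=> i hi; apply/eqP => ai; apply: noz; exists i.
move=> /mulIf h; have /h : (pi / 2 : R) != 0.
  by rewrite gt_eqF // divr_gt0 ?pi_gt0.
have : (k%:R <= n%:R :> R) by rewrite ler_nat.
lra.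
Qed.

(** r - 2 A_n has degree less than n, as the leading terms cancel, and the n
    values lambda_1, ..., lambda_n as distinct roots. *)
Lemma arctan_poly_unique (R : realType) (alpha : nat -> R) (n : nat)
    (lambda : nat -> R) (r : {poly R}) (q : {poly R[i]}) :
  arctan_poly alpha n lambda r q -> r = 2 *: tangent_re R alpha n.
Proof.
move=> [_ sr lr sol]; have [mA sA _] := size_tangent R alpha n.
apply/eqP; rewrite -subr_eq0; apply/negPn/negP => d0.
set d := r - _ in d0.
have ds : (size d <= n)%N.
  apply/leq_sizeP => j; rewrite leq_eqVlt coefB coefZ => /orP[/eqP<-|nj].
    move: lr mA; rewrite monicE !lead_coefE sr sA /= => -> /eqP->.
    by rewrite mulr1 subrr.
  by rewrite !nth_default ?sr ?sA // mulr0 subrr.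
pose rs := [seq lambda k | k <- iota 1 n].
have k1n k : k \in iota 1 n -> (1 <= k <= n)%N by rewrite mem_iota add1n ltnS.
have rsd : all (root d) rs.
  apply/allP => _ /mapP[k /k1n hk ->]; have [hs hr] := sol k hk.
  have /rootP hA := root_of_solution R alpha n k _ hk hs.
  by apply/rootP; rewrite !hornerE hA (rootP hr) mulr0 subrr.
have rsu : uniq rs.
  rewrite map_inj_in_uniq ?iota_uniq // => k l /k1n hk /k1n hl elam.
  have [[_ ek] _] := sol k hk; have [[_ el] _] := sol l hl.
  move: ek; rewrite elam el => /mulIf h.
  have /h e : (pi / 2 : R) != 0 by rewrite gt_eqF // divr_gt0 ?pi_gt0.
  by apply/eqP; rewrite -(eqr_nat R); apply/eqP; lra.
have := max_poly_roots d0 rsd rsu.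
by rewrite size_map size_iota ltnNge ds.
Qed.

Lemma Re_at_half (R : realType) (r : {poly R}) (q : {poly R[i]}) (x : R) :
  map_poly (real_complex R) r = q + conj_poly q -> r.[x] = 2 * Re_at q x.
Proof.
move=> /(congr1 (fun p => p.[(x%:C)%C])); rewrite hornerD horner_map /=.
have -> : (conj_poly q).[(x%:C)%C] = conjc q.[(x%:C)%C].
  by rewrite /conj_poly -[X in (map_poly _ _).[X]]conjc_real horner_map.
rewrite /Re_at; case: (q.[_]) => a b /= [-> _].
by rewrite mulr_natl mulr2n.
Qed.

Theorem proposition3p1 (R : realType) (N : nat) (alpha : nat -> R)
    (lambda : nat -> nat -> R) (Rp : nat -> {poly R}) (Q : nat -> {poly R[i]})
    (alpha_ge0 : forall i : nat, (1 <= i <= N)%N -> 0 <= alpha i)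
    (RpQ : forall n : nat, (n <= N)%N ->
       arctan_poly alpha n (lambda n) (Rp n) (Q n)) :
  [/\ forall x : R, Re_at (Q 0%N) x = 1,
      (1 <= N)%N ->
        forall x : R, Re_at (Q 1%N) x = x - (alpha 1%N + 1) ^+ 2 / 4 &
      forall n : nat, (2 <= n <= N)%N -> alpha n.-1 != 0 ->
        forall x : R,
          Re_at (Q n) x =
            ((4 * x - 1 - alpha n * alpha n.-1) / alpha n.-1)
              * ((alpha n + alpha n.-1) / 4) * Re_at (Q n.-1) x
            - alpha n / alpha n.-1
              * (x + (alpha n.-1 ^+ 2 - 1) / 4) ^+ 2 * Re_at (Q n.-2) x].
Proof.
have ReQ n x : (n <= N)%N -> Re_at (Q n) x = (tangent_re R alpha n).[x].
  move=> /RpQ h; have [/(Re_at_half R _ _ x) e _ _ _] := h.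
  move: e; rewrite (arctan_poly_unique R _ _ _ _ _ h) hornerZ => /mulfI e.
  by apply/esym/e; rewrite pnatr_eq0.
split=> [x|N1 x|].
- by rewrite ReQ // /tangent_re /= hornerC.
- rewrite ReQ // horner_tangent_reS /tangent_re /tangent_im /= hornerC.
  by field.
case=> [|[|n]] //= nN a0 x.
have nN1 := ltnW nN; have nN0 := ltnW nN1.
rewrite !ReQ //.
rewrite (horner_tangent_reS _ _ n.+1) horner_tangent_imS.
rewrite !horner_tangent_reS.
by field.
Qed.
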